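(* Let $\phi:Y\to X$ be a polygonal covering map, where $X$ and $Y$ are finite connected (polygonal) 2-complexes, such that $\phi$ is filling and $H_2(X;\mathbb{Z})\neq 0$. Then $$\xi_2(X;\mathbb{Z})\le \kappa_2(X;\mathbb{Z})\,\frac{2\operatorname{diam}(Y^{(1)})+1}{\rho_1(X;\mathbb{Z})}+1.$$
   Context: A (polygonal) 2-complex is a cell complex of dimension 2 whose 2-cells are regular polygons with every boundary edge of length $1$, attached along edge loops. A continuous map of 2-complexes is polygonal if it sends $i$-cells to $i$-cells homeomorphically. $Y^{(1)}$ is the 1-skeleton and $\operatorname{diam}(Y^{(1)})$ is its diameter in the path metric with edges of length $1$. A polygonal map $\phi:Y\to X$ is filling if $\phi_*:H_1(Y;\mathbb{Z})\to H_1(X;\mathbb{Z})$ is the zero map. For a finite 2-complex $X$, the cellular chain groups $C_p(X;\mathbb{Z})$ carry the $\ell^1$ norm with respect to the basis of $p$-cells: $\|\sum a_i\sigma_i\|=\sum|a_i|$. For an exact 1-cycle $z\in\partial C_2(X;\mathbb{Z})$ set $\mathsf{fill}_1(z;\mathbb{Z})=\inf\{\|A\| : A\in C_2(X;\mathbb{Z}),\ \partial A=z\}$. Define $$\rho_1(X;\mathbb{Z})=\inf_{0\ne z\in\partial C_2(X;\mathbb{Z})}\frac{\|z\|}{\mathsf{fill}_1(z;\mathbb{Z})}$$ (with the usual conventions $\inf\emptyset=+\infty$, $1/\infty=0$). Since $X$ is a 2-complex, $H_2(X;\mathbb{Z})$ is identified with the group of 2-cycles $\ker(\partial_2)\subset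 C_2(X;\mathbb{Z})$. If $H_2(X;\mathbb{Z})$ has rank $b>0$, $$\xi_2(X;\mathbb{Z})=\inf\Bigl\{\max_{1\le j\le b}\|S_j\| : S_1,\dots,S_b\in H_2(X;\mathbb{Z})\text{ generate a rank } b\text{ subgroup of }H_2(X;\mathbb{Z})\Bigr\}.$$ When $H_2(X;\mathbb{Z})\ne0$, the 2-cycle curvature $\kappa_2(X;\mathbb{Z})$ is the maximum, over all 2-cells $\sigma$ in the support of some 2-cycle in $\ker(\partial_2)\subset C_2(X;\mathbb{Z})$, of the length of the boundary of $\sigma$ as a cellular path. *)

(* Defs.v *)
From HB Require Import structures.
From mathcomp Require Import all_boot all_order all_algebra.
From mathcomp Require Import all_classical all_reals all_analysis.

Set Implicit Arguments.
Unset Strict Implicit.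
Unset Printing Implicit Defensive.

Import Order.TTheory GRing.Theory Num.Theory.

Local Open Scope classical_set_scope.
Local Open Scope ring_scope.

(** ** Finite polygonal 2-complexes

    A finite polygonal 2-complex is encoded by its cells and attaching maps.
    The 1-skeleton is a multigraph (loops and multiple edges allowed), each edge
    carrying the reference orientation from [src] to [tgt].  A dart [(e, b)] is
    the edge [e] traversed along its reference orientation if [b = false] and
    against it if [b = true]. *)

Definition dart_org (V E : Type) (s t : E -> V) (d : E * bool) : V :=
  if d.2 then t d.1 else s d.1.

(** The 2-cell [f] is a polygon with [sides f] sides; its [i]-th side runs from
    corner [i] to corner [ordS i] (cyclic successor) and is attached along the
    dart [bd f i].  The first [dart_org] in [bd_loop] is taken with [src] and
    [tgt] exchanged, i.e. it is the end point of the dart. *)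
Record complex2 := Complex2 {
  vert : finType;
  edge : finType;
  face : finType;
  src : edge -> vert;
  tgt : edge -> vert;
  sides : face -> nat;
  sides_gt0 : forall f, (0 < sides f)%N;
  bd : forall f, 'I_(sides f) -> edge * bool;
  bd_loop : forall f (i : 'I_(sides f)),
    dart_org tgt src (bd i) = dart_org src tgt (bd (ordS i))
}.

Arguments src : clear implicits.
Arguments tgt : clear implicits.
Arguments sides : clear implicits.
Arguments bd : clear implicits.

Definition dart (X : complex2) : Type := (edge X * bool)%type.

Definition dinv (X : complex2) (d : dart X) : dart X := (d.1, ~~ d.2).

Definition org (X : complex2) (d : dart X) : vert X :=
  dart_org (src X) (tgt X) d.

Definition ter (X : complex2) (d : dart X) : vert X :=
  dart_org (tgt X) (src X) d.

Definition adj (X : complex2) : rel (vert X) :=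
  fun u v => [exists e : edge X,
    ((src X e == u) && (tgt X e == v)) || ((src X e == v) && (tgt X e == u))].

(** Connected spaces are nonempty; a cell complex is connected if and only if
    its 1-skeleton is. *)
Definition connected_complex (X : complex2) : Prop :=
  (0 < #|vert X|)%N /\ forall u v : vert X, connect (@adj X) u v.

Definition corner (X : complex2) : Type := {f : face X & 'I_(sides X f)}.

Definition corner_org (X : complex2) (c : corner X) : vert X :=
  org (bd X (tag c) (tagged c)).

(** ** Polygonal maps

    The combinatorial data of a map sending open [i]-cells homeomorphically to
    open [i]-cells.  The edge [e] goes to the edge [(pm_edge e).1], reversed when
    [(pm_edge e).2]; the polygon [g] goes to the polygon [pm_face g] by the
    bijection [pm_corner g] of corners, which is a rotation when [pm_flip g] is
    false and a reflection when it is true.  The boundary word alone would not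
    determine this bijection (when it is a proper power, for instance), which is
    why it is part of the data; likewise [pm_flip] is not determined by
    [pm_corner] for monogons and bigons. *)

Definition dart_map (X Y : complex2) (h : edge Y -> dart X) (d : dart Y) : dart X :=
  ((h d.1).1, (h d.1).2 (+) d.2).

Record polygonal_map (Y X : complex2) := PolygonalMap {
  pm_vert : vert Y -> vert X;
  pm_edge : edge Y -> dart X;
  pm_face : face Y -> face X;
  pm_flip : face Y -> bool;
  pm_corner : forall g : face Y, 'I_(sides Y g) -> 'I_(sides X (pm_face g));
  pm_edge_src : forall e, org (pm_edge e) = pm_vert (src Y e);
  pm_edge_tgt : forall e, ter (pm_edge e) = pm_vert (tgt Y e);
  pm_corner_bij : forall g, bijective (@pm_corner g);
  pm_cornerS : forall g (i : 'I_(sides Y g)),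
    pm_corner (ordS i) =
      if pm_flip g then ord_pred (pm_corner i) else ordS (pm_corner i);
  pm_side : forall g (i : 'I_(sides Y g)),
    dart_map pm_edge (bd Y g i) =
      if pm_flip g then dinv (bd X (pm_face g) (pm_corner (ordS i)))
      else bd X (pm_face g) (pm_corner i)
}.

Arguments pm_corner {Y X} p g _.

Definition pm_dart (Y X : complex2) (phi : polygonal_map Y X) : dart Y -> dart X :=
  dart_map (pm_edge phi).

Definition pm_corners (Y X : complex2) (phi : polygonal_map Y X) (c : corner Y) :
    corner X :=
  existT (fun f => 'I_(sides X f)) (pm_face phi (tag c))
    (pm_corner phi (tag c) (tagged c)).

(** The link of a vertex [v] is the graph whose vertices are the darts issuing
    from [v] and whose edges are the polygon corners at [v], and a small
    neighbourhood of [v] is the cone over it.  A polygonal map is therefore a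
    local homeomorphism iff it maps the link of each vertex [y] isomorphically
    onto the link of its image, and between finite complexes the covering maps
    are the surjective local homeomorphisms. *)
Definition covering (Y X : complex2) (phi : polygonal_map Y X) : Prop :=
  [/\ forall x, exists y, pm_vert phi y = x,
      forall (y : vert Y) (d : dart X), org d = pm_vert phi y ->
        exists! d' : dart Y, org d' = y /\ pm_dart phi d' = d &
      forall (y : vert Y) (c : corner X), corner_org c = pm_vert phi y ->
        exists! c' : corner Y, corner_org c' = y /\ pm_corners phi c' = c].

(** ** Cellular chains with integer coefficients *)

Definition chain0 (X : complex2) := {ffun vert X -> int}.
Definition chain1 (X : complex2) := {ffun edge X -> int}.
Definition chain2 (X : complex2) := {ffun face X -> int}.

Definition basis_chain (I : finType) (i : I) : {ffun I -> int} :=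
  [ffun j => (j == i)%:R].

Definition dart_chain (X : complex2) (d : dart X) : chain1 X :=
  if d.2 then - basis_chain d.1 else basis_chain d.1.

Definition bound1 (X : complex2) (z : chain1 X) : chain0 X :=
  \sum_(e : edge X) (basis_chain (tgt X e) - basis_chain (src X e)) *~ z e.

Definition bound2 (X : complex2) (A : chain2 X) : chain1 X :=
  \sum_(f : face X) (\sum_(i < sides X f) dart_chain (bd X f i)) *~ A f.

Definition push1 (Y X : complex2) (phi : polygonal_map Y X) (z : chain1 Y) :
    chain1 X :=
  \sum_(e : edge Y) dart_chain (pm_edge phi e) *~ z e.

Definition cycles1 (X : complex2) : set (chain1 X) := [set z | bound1 z = 0].
Definition boundaries1 (X : complex2) : set (chain1 X) := range (@bound2 X).

(** [H_2(X; Z)], as a subgroup of the group of 2-chains. *)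
Definition H2 (X : complex2) : set (chain2 X) := [set A | bound2 A = 0].

(** The map induced on [H_1 = cycles1 / boundaries1] is zero. *)
Definition filling (Y X : complex2) (phi : polygonal_map Y X) : Prop :=
  forall z, cycles1 z -> boundaries1 (push1 phi z).

(** The l^1 norm. *)
Definition norm1 (I : finType) (c : {ffun I -> int}) : nat :=
  (\sum_(i : I) `|c i|)%N.

(** ** Rank of a subgroup of an abelian group *)

Definition zindep (V : zmodType) n (S : 'I_n -> V) : Prop :=
  forall a : 'I_n -> int, \sum_(i < n) S i *~ a i = 0 -> forall i, a i = 0.

Definition zspan (V : zmodType) n (S : 'I_n -> V) : set V :=
  range (fun a : 'I_n -> int => \sum_(i < n) S i *~ a i).

Definition has_rank (V : zmodType) (H : set V) (b : nat) : Prop :=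
  (exists S : 'I_b -> V, (forall i, H (S i)) /\ zindep S) /\
  (forall n (S : 'I_n -> V), (forall i, H (S i)) -> zindep S -> (n <= b)%N).

(** ** The path metric on the 1-skeleton and its diameter

    The 1-skeleton is a metric graph: its points are the vertices and the points
    [Inner e t], [0 < t < 1], at distance [t] from [src e] along [e].  The
    distance is the infimum of the lengths of piecewise linear paths; such a
    path is a list of segments [(e, a, b)], running in the closed edge [e] from
    parameter [a] to parameter [b].  The diameter ranges over all points of the
    graph, not only over its vertices. *)

Inductive skel_point (R : Type) (X : complex2) : Type :=
  | Vertex of vert X
  | Inner of edge X & R.

Arguments Vertex {R X} _.
Arguments Inner {R X} _ _.

Definition skeleton (R : realType) (X : complex2) : set (skel_point R X) :=
  [set p | match p with Vertex _ => True | Inner _ t => 0 < t < 1 end].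

Definition edge_point (R : realType) (X : complex2) (e : edge X) (t : R) :
    skel_point R X :=
  if t == 0 then Vertex (src X e)
  else if t == 1 then Vertex (tgt X e)
  else Inner e t.

Fixpoint is_pl_path (R : realType) (X : complex2)
    (p : skel_point R X) (s : seq (edge X * R * R)) (q : skel_point R X) : Prop :=
  match s with
  | [::] => p = q
  | (e, a, b) :: s' =>
      [/\ 0 <= a <= 1, 0 <= b <= 1, p = edge_point e a
        & is_pl_path (edge_point e b) s' q]
  end.

Definition pl_length (R : realType) (X : complex2) (s : seq (edge X * R * R)) : R :=
  \sum_(x <- s) `|x.1.2 - x.2|.

Definition skel_dist (R : realType) (X : complex2) (p q : skel_point R X) : \bar R :=
  ereal_inf [set (pl_length s)%:E | s in [set s | is_pl_path p s q]].

Definition diam (R : realType) (X : complex2) : \bar R :=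
  ereal_sup [set x | exists p q : skel_point R X,
    [/\ skeleton p, skeleton q & x = skel_dist p q]].

(** ** The invariants *)

Definition fill1 (R : realType) (X : complex2) (z : chain1 X) : \bar R :=
  ereal_inf [set (norm1 A)%:R%:E | A in [set A : chain2 X | bound2 A = z]].

Definition rho1 (R : realType) (X : complex2) : \bar R :=
  ereal_inf [set ((norm1 z)%:R%:E / fill1 R z)%E
    | z in [set z : chain1 X | boundaries1 z /\ z != 0]].

(** The integer [b] below is determined by [X]: it is the rank of [H2 X]. *)
Definition xi2 (R : realType) (X : complex2) : \bar R :=
  ereal_inf [set x | exists (b : nat) (S : 'I_b -> chain2 X),
    [/\ has_rank (@H2 X) b, forall j, H2 (S j), has_rank (zspan S) b
      & x = (\max_(j < b) norm1 (S j))%:R%:E]].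

Definition kappa2 (X : complex2) : nat :=
  \max_(f : face X | `[< exists2 A : chain2 X, H2 A & A f != 0 >]) sides X f.

(* Main.v *)
(** Joining the endpoints of an edge of [Y] to a base point by shortest chains
    closes it up to a 1-cycle of norm at most [2 diam + 1]; as [phi] is filling,
    its image in [X] bounds a 2-chain of norm at most [(2 diam + 1) / rho1].  For
    a 2-cell [g] of [Y], subtracting from [phi(g)] the fillings of its sides
    yields a 2-cycle [S g] of [X], of norm at most
    [1 + kappa2 (2 diam + 1) / rho1] when [phi(g)] lies in the support of a
    2-cycle.  A 2-cycle [Z] of [X] lifts to the 2-cycle of [Y] with coefficients
    [Z (phi g)], up to sign; in the corresponding combination of the [S g] the
    fillings cancel and each cell of [Z] is counted once for each of its lifts.
    Hence the cycles [S g] span a subgroup of full rank. *)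

Require Import Defs.
From HB Require Import structures.
From mathcomp Require Import all_boot all_order all_algebra.
From mathcomp Require Import zify ring lra.
From mathcomp Require Import all_classical all_reals all_analysis.

Set Implicit Arguments.
Unset Strict Implicit.
Unset Printing Implicit Defensive.

Import Order.TTheory GRing.Theory Num.Theory.
(* MathComp-Analysis has another [dinv]. *)
Import Defs.

Local Open Scope classical_set_scope.
Local Open Scope ring_scope.

(** * Chains on a finite basis *)

(** The homomorphism that freeness of the chain group on [I] provides. [bound1], [bound2] and
    [push1] unfold to it and inherit its additivity. *)
Definition lin (I : finType) (V : zmodType) (F : I -> V) (z : {ffun I -> int}) : V :=
  \sum_i F i *~ z i.

Lemma lin_is_zmod_morphism (I : finType) (V : zmodType) (F : I -> V) :
  zmod_morphism (lin F).
Proof.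
move=> a b; rewrite /lin -sumrB; apply: eq_bigr => i _.
by rewrite !ffunE mulrzBr.
Qed.

HB.instance Definition _ (I : finType) (V : zmodType) (F : I -> V) :=
  GRing.isZmodMorphism.Build {ffun I -> int} V (lin F) (lin_is_zmod_morphism F).

Lemma lin_basis (I : finType) (V : zmodType) (F : I -> V) i :
  lin F (basis_chain i) = F i.
Proof.
rewrite /lin (bigD1 i) //= ffunE eqxx mulr1z big1 ?addr0 // => j /negbTE ji.
by rewrite ffunE ji.
Qed.

Lemma raddf_lin (I : finType) (V W : zmodType) (f : {additive V -> W})
    (F : I -> V) z :
  f (lin F z) = lin (fun i => f (F i)) z.
Proof. by rewrite raddf_sum; apply: eq_bigr => i _; rewrite raddfMz. Qed.

Lemma eq_lin (I : finType) (V : zmodType) (F G : I -> V) z :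
  F =1 G -> lin F z = lin G z.
Proof. by move=> FG; apply: eq_bigr => i _; rewrite FG. Qed.

Lemma lin_basis_chain (I : finType) (z : {ffun I -> int}) :
  lin (@basis_chain I) z = z.
Proof.
apply/ffunP => j; rewrite /lin sum_ffunE (bigD1 j) //= big1 => [|i /negbTE ij].
  by rewrite addr0 ffunMzE ffunE eqxx intz.
by rewrite ffunMzE ffunE eq_sym ij mul0rz.
Qed.

Lemma additive_lin (I : finType) (W : zmodType)
    (f : {additive {ffun I -> int} -> W}) z :
  f z = lin (fun i => f (basis_chain i)) z.
Proof. by rewrite -[in LHS](lin_basis_chain z) raddf_lin. Qed.

Lemma norm1_eq0 (I : finType) (z : {ffun I -> int}) :
  (norm1 z == 0%N) = (z == 0).
Proof.
rewrite sum_nat_eq0; apply/forallP/eqP => [z0|-> i]; last by rewrite ffunE.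
by apply/ffunP => i; move: (z0 i); rewrite ffunE absz_eq0 => /eqP.
Qed.

Lemma norm1_0 (I : finType) : norm1 (0 : {ffun I -> int}) = 0%N.
Proof. by apply/eqP; rewrite norm1_eq0. Qed.

Lemma norm1D (I : finType) (a b : {ffun I -> int}) :
  (norm1 (a + b)%R <= norm1 a + norm1 b)%N.
Proof.
rewrite -big_split leq_sum // => i _.
by rewrite ffunE -lez_nat PoszD !abszE ler_normD.
Qed.

Lemma norm1N (I : finType) (a : {ffun I -> int}) : norm1 (- a) = norm1 a.
Proof. by apply: eq_bigr => i _; rewrite ffunE abszN. Qed.

Lemma norm1Mz (I : finType) (a : {ffun I -> int}) n :
  norm1 (a *~ n) = (norm1 a * `|n|)%N.
Proof.
rewrite /norm1 big_distrl; apply: eq_bigr => i _ /=.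
by rewrite ffunMzE mulrzz abszM.
Qed.

Lemma norm1_sum (I J : finType) (F : J -> {ffun I -> int}) :
  (norm1 (\sum_j F j)%R <= \sum_j norm1 (F j))%N.
Proof.
elim/big_ind2 : _ => [|a m b n am bn|//]; first by rewrite norm1_0.
exact: leq_trans (norm1D _ _) (leq_add am bn).
Qed.

Lemma norm1_basis (I : finType) (i : I) : norm1 (basis_chain i) = 1%N.
Proof.
rewrite /norm1 (bigD1 i) //= ffunE eqxx big1 ?addn0 // => j /negbTE ji.
by rewrite ffunE ji.
Qed.

Lemma norm1_lin (I J : finType) (F : J -> {ffun I -> int}) M z :
  (forall j, norm1 (F j) <= M)%N -> (norm1 (lin F z) <= M * norm1 z)%N.
Proof.
move=> FM; apply: leq_trans (norm1_sum _) _.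
rewrite [norm1 z]/norm1 big_distrr leq_sum //= => j _.
by rewrite norm1Mz leq_mul.
Qed.

(** * Boundary and push-forward on basis cells *)

HB.instance Definition _ (X : complex2) :=
  GRing.isZmodMorphism.Build (chain1 X) (chain0 X) (@bound1 X)
    (lin_is_zmod_morphism _).
HB.instance Definition _ (X : complex2) :=
  GRing.isZmodMorphism.Build (chain2 X) (chain1 X) (@bound2 X)
    (lin_is_zmod_morphism _).
HB.instance Definition _ (Y X : complex2) (phi : polygonal_map Y X) :=
  GRing.isZmodMorphism.Build (chain1 Y) (chain1 X) (push1 phi)
    (lin_is_zmod_morphism _).

Lemma bound1_basis (X : complex2) (e : edge X) :
  bound1 (basis_chain e) = basis_chain (tgt X e) - basis_chain (src X e).
Proof. exact: lin_basis. Qed.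

Definition cell_bound (X : complex2) (f : face X) : chain1 X :=
  \sum_(i < sides X f) dart_chain (bd X f i).

Lemma bound2_basis (X : complex2) (f : face X) :
  bound2 (basis_chain f) = cell_bound f.
Proof. exact: lin_basis. Qed.

Lemma dart_chainE (X : complex2) (d : dart X) :
  dart_chain d = basis_chain d.1 *~ (-1) ^+ d.2.
Proof. by case: d => e [] //=; rewrite mulrN1z. Qed.

Lemma dart_chain_dinv (X : complex2) (d : dart X) :
  dart_chain (dinv d) = - dart_chain d.
Proof. by case: d => e [] //; rewrite /dart_chain /= opprK. Qed.

Lemma bound1_dart (X : complex2) (d : dart X) :
  bound1 (dart_chain d) = basis_chain (ter d) - basis_chain (org d).
Proof.
by case: d => e [] /=; rewrite /dart_chain /= ?raddfN /= bound1_basis ?opprB.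
Qed.

Lemma norm1_dart (X : complex2) (d : dart X) : norm1 (dart_chain d) = 1%N.
Proof. by case: d => e []; rewrite /dart_chain /= ?norm1N norm1_basis. Qed.

Lemma push1_dart (Y X : complex2) (phi : polygonal_map Y X) (d : dart Y) :
  push1 phi (dart_chain d) = dart_chain (pm_dart phi d).
Proof.
rewrite (dart_chainE d) raddfMz /= [push1 _ _]lin_basis !dart_chainE /=.
by rewrite -mulrzA -signr_addb.
Qed.

Lemma norm1_push1 (Y X : complex2) (phi : polygonal_map Y X) (z : chain1 Y) :
  (norm1 (push1 phi z) <= norm1 z)%N.
Proof.
by rewrite -[leqRHS]mul1n; apply: norm1_lin => e; rewrite norm1_dart.
Qed.

Lemma norm1_cell_bound (X : complex2) (f : face X) :
  (norm1 (cell_bound f) <= sides X f)%N.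
Proof.
apply: leq_trans (norm1_sum _) _.
by under eq_bigr do rewrite norm1_dart; rewrite sum1_card card_ord.
Qed.

(** Each side ends where the next begins, so the end points are the origins reindexed by the cyclic
    successor. *)
Lemma cell_bound_cycle (X : complex2) (f : face X) : bound1 (cell_bound f) = 0.
Proof.
rewrite raddf_sum /=.
under eq_bigr do rewrite bound1_dart /ter bd_loop.
rewrite sumrB [X in _ - X](reindex _ (onW_bij _ (@ordS_bij _))) /=.
by rewrite subrr.
Qed.

(** * Lifting 2-cycles along a covering *)

Definition pm_sign (Y X : complex2) (phi : polygonal_map Y X) (g : face Y) : int :=
  (-1) ^+ pm_flip phi g.

Lemma pm_signK (Y X : complex2) (phi : polygonal_map Y X) (g : face Y) :
  pm_sign phi g * pm_sign phi g = 1.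
Proof. by rewrite /pm_sign -signr_addb addbb. Qed.

(* The side of [g] lying over the side [pm_corner phi g i] of its image, oriented
   so that it issues from the corner [i]: it is the preceding side of [g],
   reversed, when [phi] reflects [g]. *)
Definition lift_side (Y X : complex2) (phi : polygonal_map Y X) (g : face Y)
    (i : 'I_(sides Y g)) : dart Y :=
  if pm_flip phi g then dinv (bd Y g (ord_pred i)) else bd Y g i.

Lemma org_lift_side (Y X : complex2) (phi : polygonal_map Y X) g i :
  org (lift_side phi i) = org (bd Y g i).
Proof.
rewrite /lift_side; case: ifP => // _.
rewrite -[in RHS](ord_predK i) /org -bd_loop.
by case: (bd _ _ _) => e [].
Qed.

Lemma pm_lift_side (Y X : complex2) (phi : polygonal_map Y X) g i :
  pm_dart phi (lift_side phi i) = bd X (pm_face phi g) (pm_corner phi g i).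
Proof.
have := pm_side phi (if pm_flip phi g then ord_pred i else i).
rewrite /lift_side; case: ifP => // _; rewrite ord_predK => H.
have -> : pm_dart phi (dinv (bd Y g (ord_pred i))) =
    dinv (dart_map (pm_edge phi) (bd Y g (ord_pred i))).
  by rewrite /pm_dart /dinv /dart_map /= addbN.
by rewrite H /dinv /= negbK -surjective_pairing.
Qed.

(** A reflection reverses every side and shifts the index cyclically; only a global sign survives in
    the sum. *)
Lemma cell_bound_lift (Y X : complex2) (phi : polygonal_map Y X) g :
  cell_bound g = (\sum_i dart_chain (lift_side phi (g := g) i)) *~ pm_sign phi g.
Proof.
rewrite /pm_sign /lift_side /cell_bound; case: (pm_flip phi g) => /=; last by rewrite mulr1z.
under [in RHS]eq_bigr do rewrite dart_chain_dinv.
rewrite sumrN mulrN1z opprK.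
by rewrite (reindex _ (onW_bij _ (@ord_pred_bij _))).
Qed.

Lemma push1_cell_bound (Y X : complex2) (phi : polygonal_map Y X) g :
  push1 phi (cell_bound g) = cell_bound (pm_face phi g) *~ pm_sign phi g.
Proof.
rewrite (cell_bound_lift phi) raddfMz raddf_sum /=; congr (_ *~ _).
rewrite [RHS](reindex _ (onW_bij _ (pm_corner_bij phi g))) /=.
by apply: eq_bigr => i _; rewrite push1_dart pm_lift_side.
Qed.

(** The sign passes from the reference orientation of [g] to the one lifted from its image. *)
Definition transfer (Y X : complex2) (phi : polygonal_map Y X) (Z : chain2 X) :
    chain2 Y :=
  [ffun g => pm_sign phi g * Z (pm_face phi g)].

Lemma dart_chain_coef (X : complex2) (d : dart X) e :
  dart_chain d e = (d == (e, false))%:R - (d == (e, true))%:R.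
Proof.
case: d => e' b; rewrite !xpair_eqE /dart_chain eq_sym.
by case: b; rewrite /= !ffunE ?andbT ?andbF ?subr0 ?sub0r.
Qed.

(** Darts are weighed rather than edges because a covering lifts darts and corners uniquely; an edge
    coefficient of a boundary is the difference of two such weights. *)
Definition dart_weight (X : complex2) (F : finType) (n : F -> nat)
    (side : forall f, 'I_(n f) -> dart X) (w : F -> int) (d : dart X) : int :=
  \sum_(c : {f : F & 'I_(n f)} | side (tag c) (tagged c) == d) w (tag c).

Lemma dart_weight_coef (X : complex2) (F : finType) (n : F -> nat)
    (side : forall f, 'I_(n f) -> dart X) (w : F -> int) e :
  (\sum_f (\sum_i dart_chain (side f i)) *~ w f) e =
  dart_weight side w (e, false) - dart_weight side w (e, true).
Proof.
rewrite /dart_weight 2!(big_mkcond (fun c : {f : F & 'I_(n f)} => _ == _)) /=.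
rewrite -sumrB.
rewrite -(sig_big_dep xpredT (fun _ => xpredT) (fun f i =>
  (if side f i == (e, false) then w f else 0) -
  (if side f i == (e, true) then w f else 0))) /=.
rewrite sum_ffunE; apply: eq_bigr => f _.
rewrite ffunMzE sum_ffunE mulrzz mulr_suml; apply: eq_bigr => i _.
by rewrite dart_chain_coef mulrBl; do 2!case: eqP; rewrite ?mul1r ?mul0r.
Qed.

(** Unique lifting matches the corners of [Y] with lifted side [d] to the corners of [X] whose side
    is the image of [d]. Dart weights therefore agree, and the boundary vanishes with that of
    [Z]. *)
Lemma transfer_cycle (Y X : complex2) (phi : polygonal_map Y X) (Z : chain2 X) :
  covering phi -> bound2 Z = 0 -> bound2 (transfer phi Z) = 0.
Proof.
move=> [_ dart_lift corner_lift] Z0.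
set Wx := dart_weight (bd X) Z.
set Wy := dart_weight (@lift_side Y X phi) (fun g => Z (pm_face phi g)).
have WE d : Wy d = Wx (pm_dart phi d).
  rewrite /Wy /Wx /dart_weight.
  rewrite (partition_big (fun c : {g : face Y & 'I_(sides Y g)} =>
      pm_corners phi c : {f : face X & 'I_(sides X f)})
    (fun c => bd X (tag c) (tagged c) == pm_dart phi d)) /=; last first.
    by move=> [g i] /= /eqP <-; rewrite pm_lift_side.
  apply: eq_bigr => -[f j] /= /eqP fj.
  have orgE : org (bd X f j) = pm_vert phi (org d).
    rewrite fj; case: d {fj} => e [] /=; rewrite /org /dart_org /= ?addbT ?addbF.
      by rewrite -pm_edge_tgt /ter /dart_org; case: (pm_edge phi e).2.
    by rewrite -pm_edge_src.
  have [d' [[orgd' d'E] d'_uniq]] := dart_lift _ _ orgE.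
  have [[g i] [[orgc cE] c_uniq]] := corner_lift _ (existT _ f j) orgE.
  have dE : d' = d by apply: d'_uniq.
  (* The fibre is a single corner: its lifted side and [d] lift the same dart from the same vertex,
     hence coincide. *)
  rewrite (big_pred1 (existT _ g i)) /=.
    by have /(congr1 (fun c : corner X => tag c)) /= -> := cE.
  move=> c'; apply/andP/eqP => [[/eqP lift_d /eqP c'E]|->].
    symmetry; apply: c_uniq; split=> //.
    by rewrite -lift_d org_lift_side.
  split; last exact/eqP.
  apply/eqP; rewrite -dE; symmetry; apply: d'_uniq.
  rewrite org_lift_side; split=> //.
  rewrite pm_lift_side.
  exact: (congr1 (fun c : corner X => bd X (tag c) (tagged c)) cE).
apply/ffunP => e; rewrite ffunE.
have -> : bound2 (transfer phi Z) e = Wy (e, false) - Wy (e, true).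
  rewrite -dart_weight_coef; congr (fun_of_fin _ e); apply: eq_bigr => g _.
  rewrite -/(cell_bound g) (cell_bound_lift phi) ffunE -mulrzA.
  by rewrite mulrA pm_signK mul1r.
rewrite !WE /pm_dart /dart_map /= addbF addbT.
(* If [phi] reverses [e], the two weights trade places, which only negates a difference already
   zero. *)
have := dart_weight_coef (bd X) Z (pm_edge phi e).1.
rewrite -/(bound2 Z) Z0 ffunE -/Wx.
by case: (pm_edge phi e).2 => /= H; apply/eqP; lia.
Qed.

(** A polygon has at least one corner, which lifts at any vertex over its origin. *)
Lemma covering_face_surj (Y X : complex2) (phi : polygonal_map Y X) (f : face X) :
  covering phi -> exists g, pm_face phi g = f.
Proof.
move=> [vert_surj _ corner_lift].
pose c : corner X := existT _ f (Ordinal (sides_gt0 f)).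
have [y yE] := vert_surj (corner_org c).
have [c' [[_ c'E] _]] := corner_lift y c (esym yE).
by exists (tag c'); exact: (congr1 (fun c : corner X => tag c) c'E).
Qed.

Lemma pm_sides (Y X : complex2) (phi : polygonal_map Y X) (g : face Y) :
  sides X (pm_face phi g) = sides Y g.
Proof.
by have /bij_eq_card := pm_corner_bij phi g; rewrite !card_ord => ->.
Qed.

(** The composite of [transfer] with the push-forward of 2-chains, in diagonal form: the signs
    cancel. *)
Definition sheet_mult (Y X : complex2) (phi : polygonal_map Y X) : chain2 X -> chain2 X :=
  lin (fun f => basis_chain f *~ #|[set g | pm_face phi g == f]%SET|%:Z).

HB.instance Definition _ (Y X : complex2) (phi : polygonal_map Y X) :=
  GRing.isZmodMorphism.Build (chain2 X) (chain2 X) (sheet_mult phi)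
    (lin_is_zmod_morphism _).

Lemma sheet_multE (Y X : complex2) (phi : polygonal_map Y X) (Z : chain2 X) :
  sheet_mult phi Z = \sum_g basis_chain (pm_face phi g) *~ Z (pm_face phi g).
Proof.
rewrite (partition_big (pm_face phi) xpredT) //=; apply: eq_bigr => f _.
rewrite (eq_bigr (fun=> basis_chain f *~ Z f)) => [|g /eqP -> //].
by rewrite sumr_const cardsE -mulrzA mulrC mulrzA pmulrn.
Qed.

Lemma sheet_mult_inj (Y X : complex2) (phi : polygonal_map Y X) :
  covering phi -> injective (sheet_mult phi).
Proof.
move=> phi_cov; apply: raddf_inj => Z /ffunP Z0; apply/ffunP => f.
have := Z0 f; rewrite /sheet_mult /lin sum_ffunE (bigD1 f) //= big1 => [|f' ff'].
  rewrite addr0 !ffunMzE !ffunE eqxx intz mulrzz => /eqP.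
  rewrite mulf_eq0 => /orP[|/eqP //].
  have [g gE] := covering_face_surj f phi_cov.
  by rewrite eqz_nat cards_eq0 => /eqP/setP/(_ g); rewrite !inE gE eqxx.
by rewrite !ffunMzE ffunE eq_sym (negPf ff') !mul0rz.
Qed.

(** * Ranks *)

Definition rat_rows n (I : finType) (S : 'I_n -> {ffun I -> int}) : 'M[rat]_(n, #|I|) :=
  \matrix_(i, j) (S i (enum_val j))%:~R.

Lemma mul_rat_rows n (I : finType) (S : 'I_n -> {ffun I -> int}) (a : 'I_n -> int) :
  (\row_i (a i)%:~R) *m rat_rows S =
  \row_j ((\sum_i S i *~ a i) (enum_val j))%:~R.
Proof.
apply/rowP => j; rewrite !mxE sum_ffunE (raddf_sum intr); apply: eq_bigr => i _.
by rewrite !mxE ffunMzE mulrzz /= intrM mulrC.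
Qed.

Lemma common_denominator n (v : 'I_n -> rat) :
  exists2 d : int, d != 0 & exists a : 'I_n -> int, forall i, d%:~R * v i = (a i)%:~R.
Proof.
exists (\prod_i denq (v i)).
  by apply/prodf_neq0 => i _; exact: denq_neq0.
exists (fun i => numq (v i) * \prod_(j | j != i) denq (v j)) => i.
by rewrite (bigD1 i) //= !intrM numqE; ring.
Qed.

(** Clearing denominators makes a rational relation integral; conversely an integral relation is a
    rational one. *)
Lemma zindep_row_free n (I : finType) (S : 'I_n -> {ffun I -> int}) :
  zindep S <-> row_free (rat_rows S).
Proof.
split=> [S_indep|S_free a Sa0 i].
  apply: inj_row_free => v vS0.
  have [d d0 [a va]] := common_denominator (fun i => v 0 i).
  have aE : \row_i (a i)%:~R = d%:~R *: v by apply/rowP => i; rewrite !mxE va.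
  have /S_indep a0 : \sum_i S i *~ a i = 0.
    have /rowP := mul_rat_rows S a; rewrite aE -scalemxAl vS0 scaler0 => H.
    apply/ffunP => x; have := H (enum_rank x).
    by rewrite !mxE enum_rankK => /esym/eqP; rewrite intr_eq0 ffunE => /eqP.
  apply/rowP => i; rewrite mxE; apply/eqP.
  by have /eqP := va i; rewrite a0 mulf_eq0 intr_eq0 (negPf d0).
have : (\row_i (a i)%:~R : 'rV[rat]_n) *m rat_rows S = 0 *m rat_rows S.
  by rewrite mul_rat_rows Sa0 mul0mx; apply/rowP => j; rewrite !mxE ffunE.
by move=> /(row_free_inj S_free) /rowP /(_ i); rewrite !mxE => /eqP; rewrite intr_eq0 => /eqP.
Qed.

Lemma zspan_ker (V W : zmodType) (f : {additive V -> W}) n (S : 'I_n -> V) :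
  (forall i, f (S i) = 0) -> forall A, zspan S A -> f A = 0.
Proof.
move=> fS _ [a _ <-]; rewrite raddf_sum big1 // => i _.
by rewrite raddfMz fS mul0rz.
Qed.

Lemma zspan_gen (V : zmodType) n (S : 'I_n -> V) i : zspan S (S i).
Proof.
exists (fun j => (j == i)%:R) => //.
by rewrite (bigD1 i) //= eqxx mulr1z big1 ?addr0 // => j /negbTE ->.
Qed.

(* [D] embeds the kernel of [f] into the span of [T], so the two have the same
   rank, which a subfamily of [T] realizes. *)
Lemma exists_full_rank (I J : finType) (W : zmodType)
    (f : {additive {ffun I -> int} -> W}) (D : {additive {ffun I -> int} -> {ffun I -> int}})
    (T : J -> {ffun I -> int}) :
  injective D -> (forall j, f (T j) = 0) ->
  (forall A, f A = 0 -> exists a : J -> int, D A = \sum_j T j *~ a j) ->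
  exists b (s : 'I_b -> J),
    has_rank [set A | f A = 0] b /\ has_rank (zspan (fun i => T (s i))) b.
Proof.
move=> D_inj fT DT.
pose T' (j : 'I_#|J|) := T (enum_val j).
(* Rows forming a basis of the row space: they select the subfamily of [T] sought. *)
pose s := maxrankfun (rat_rows T').
have s_indep : zindep (fun i => T' (s i)).
  apply/zindep_row_free.
  rewrite (_ : rat_rows _ = rowsub s (rat_rows T')) ?maxrowsub_free //.
  by apply/matrixP => i j; rewrite !mxE.
(* [D] keeps the family independent and sends it into the row space of [T']. The bound serves the
   kernel and, since the span of [T] lies in it, the span too. *)
have ub n (S : 'I_n -> {ffun I -> int}) :
    (forall i, f (S i) = 0) -> zindep S -> (n <= \rank (rat_rows T'))%N.
  move=> fS S_indep.
  have : zindep (fun i => D (S i)).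
    move=> a; under eq_bigr do rewrite -raddfMz; rewrite -raddf_sum -[RHS](raddf0 D).
    by move=> /D_inj /S_indep.
  move=> /zindep_row_free /eqP {1}<-; apply: mxrankS.
  apply/row_subP => i; have [a aE] := DT _ (fS i).
  suff -> : row i (rat_rows (fun i => D (S i))) =
      (\row_j (a (enum_val j))%:~R) *m rat_rows T' by exact: submxMl.
  rewrite mul_rat_rows; apply/rowP => j; rewrite !mxE aE.
  by rewrite (reindex _ (onW_bij _ (@enum_val_bij J))).
exists (\rank (rat_rows T')), (fun i => enum_val (s i)); split; split.
- by exists (fun i => T' (s i)); split=> // i; exact: fT.
- by move=> n S fS; exact: ub.
- by exists (fun i => T' (s i)); split=> // i; exact: (zspan_gen (fun i => T' (s i))).
- move=> n S sS; apply: ub => i; apply: zspan_ker (sS i) => k; exact: fT.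
Qed.

(** * Vertex distances and the diameter *)

Lemma connect_chain (X : complex2) (x y : vert X) :
  connect (@adj X) x y ->
  exists c : chain1 X, bound1 c = basis_chain y - basis_chain x.
Proof.
move=> /connectP[p]; elim: p x => [x _ ->|z p IHp x /= /andP[xz zp] yE].
  by exists 0; rewrite raddf0 subrr.
have [c cE] := IHp _ zp yE.
have [e eE] : exists e : chain1 X, bound1 e = basis_chain z - basis_chain x.
  case/existsP: xz => e /orP[]/andP[/eqP <- /eqP <-].
    by exists (basis_chain e); rewrite bound1_basis.
  by exists (- basis_chain e); rewrite raddfN /= bound1_basis opprB.
by exists (c + e); rewrite raddfD /= cE eE addrA subrK.
Qed.

(* The least norm of a 1-chain from [y0] to [u] serves as the distance. *)
Lemma minimal_chains (Y : complex2) (y0 : vert Y) :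
  (forall u, connect (@adj Y) y0 u) ->
  exists c : vert Y -> chain1 Y,
    [/\ forall u, bound1 (c u) = basis_chain u - basis_chain y0,
        norm1 (c y0) = 0%N &
        forall e, (norm1 (c (tgt Y e)) <= (norm1 (c (src Y e))).+1)%N /\
                  (norm1 (c (src Y e)) <= (norm1 (c (tgt Y e))).+1)%N].
Proof.
move=> Y_conn.
have min_ex u : exists c : chain1 Y, bound1 c = basis_chain u - basis_chain y0 /\
    forall c', bound1 c' = basis_chain u - basis_chain y0 -> (norm1 c <= norm1 c')%N.
  pose P n := `[< exists2 c : chain1 Y,
    bound1 c = basis_chain u - basis_chain y0 & norm1 c = n >].
  have exP : exists n, P n.
    by have [c cE] := connect_chain (Y_conn u); exists (norm1 c); apply/asboolP; exists c.
  case: (ex_minnP exP) => n /asboolP[c cE <-] c_min.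
  by exists c; split=> // c' c'E; apply: c_min; apply/asboolP; exists c'.
have [c cP] := choice min_ex; exists c; split=> [u||e].
- by have [] := cP u.
- apply/eqP; rewrite -leqn0 -(@norm1_0 (edge Y)); have [_] := cP y0; apply.
  by rewrite raddf0 subrr.
have srcE : bound1 (c (src Y e)) = basis_chain (src Y e) - basis_chain y0.
  by have [] := cP (src Y e).
have tgtE : bound1 (c (tgt Y e)) = basis_chain (tgt Y e) - basis_chain y0.
  by have [] := cP (tgt Y e).
have [_ src_min] := cP (src Y e); have [_ tgt_min] := cP (tgt Y e); split.
(* Adding or removing [e] turns a minimal chain to one end of [e] into a competitor at the other. *)
- apply: leq_trans (tgt_min (c (src Y e) + basis_chain e) _) _.
    by rewrite raddfD /= srcE bound1_basis addrC addrA subrK.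
  by apply: leq_trans (norm1D _ _) _; rewrite norm1_basis addn1.
- apply: leq_trans (src_min (c (tgt Y e) - basis_chain e) _) _.
    by rewrite raddfB /= tgtE bound1_basis opprB addrC addrA subrK.
  by apply: leq_trans (norm1D _ _) _; rewrite norm1N norm1_basis addn1.
Qed.

Section Lipschitz.
Variables (R : realType) (X : complex2) (d : vert X -> nat).
Hypothesis d_lip : forall e, (d (tgt X e) <= (d (src X e)).+1)%N /\
                             (d (src X e) <= (d (tgt X e)).+1)%N.

(** The McShane extension of [d] to the metric graph, the largest that is 1-Lipschitz. *)
Definition skel_ext (p : skel_point R X) : R :=
  match p with
  | Vertex v => (d v)%:R
  | Inner e t => Num.min ((d (src X e))%:R + t) ((d (tgt X e))%:R + 1 - t)
  end.

(** At the ends of [e] the Lipschitz bound decides which term is the minimum, so the interior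
    formula holds on the closed edge. *)
Lemma skel_ext_edge e t : skel_ext (edge_point e t) =
  Num.min ((d (src X e))%:R + t) ((d (tgt X e))%:R + 1 - t).
Proof.
have [] := d_lip e; rewrite -2!(ler_nat R) -2!natr1 => H1 H2.
rewrite /edge_point; case: eqP => [->|_] /=; last case: eqP => [->|_] //=.
- by rewrite addr0 subr0 min_l.
- by rewrite addrK min_r.
Qed.

(** Each segment stays in one closed edge, where a minimum of two functions of slope 1 and -1 grows
    by at most the length run. *)
Lemma skel_ext_lip p s q : is_pl_path p s q ->
  skel_ext q <= skel_ext p + pl_length s.
Proof.
elim: s p => [p ->|[[e a] b] s IHs p [_ _ -> {p} /IHs]]; rewrite /pl_length.
  by rewrite big_nil addr0.
rewrite big_cons /= !skel_ext_edge => /le_trans; apply.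
rewrite addrA lerD2r -lerBlDr le_min; apply/andP; split.
  rewrite lerBlDr; apply: (@le_trans _ _ ((d (src X e))%:R + b)).
    by rewrite ge_min lexx.
  by have := ler_norm (b - a); rewrite distrC; lra.
rewrite lerBlDr; apply: (@le_trans _ _ ((d (tgt X e))%:R + 1 - b)).
  by rewrite ge_min lexx orbT.
by have := ler_norm (a - b); lra.
Qed.

(** Any path from [u] to [v] is at least as long as the growth of the extension along it, so chain
    norms are compared with the diameter without exhibiting a shortest path. *)
Lemma lip_le_diam u v : d u = 0%N -> ((d v)%:R%:E <= diam R X)%E.
Proof.
move=> du0; apply: (@le_trans _ _ (skel_dist (Vertex u : skel_point R X) (Vertex v))).
  apply: le_ereal_inf_tmp => _ [s /= s_path <-].
  by rewrite lee_fin; have := skel_ext_lip s_path; rewrite /= du0 add0r.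
by apply: ereal_sup_ubound; exists (Vertex u), (Vertex v).
Qed.

End Lipschitz.

(** * Filling through [rho1] *)

Lemma fill1_ge0 (R : realType) (X : complex2) (z : chain1 X) : (0 <= fill1 R z)%E.
Proof. by apply: le_ereal_inf_tmp => _ [A _ <-]; rewrite lee_fin. Qed.

Lemma rho1_ge0 (R : realType) (X : complex2) : (0 <= rho1 R X)%E.
Proof.
apply: le_ereal_inf_tmp => _ [z _ <-].
by rewrite mule_ge0 ?lee_fin // inve_ge0 fill1_ge0.
Qed.

(** Norms are natural numbers, so the infimum [fill1] is attained; the bound then rearranges the
    inequality defining [rho1]. *)
Lemma exists_filling (R : realType) (X : complex2) (z : chain1 X) :
  boundaries1 z ->
  exists2 A, bound2 A = z & ((norm1 A)%:R%:E <= (norm1 z)%:R%:E / rho1 R X)%E.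
Proof.
have rho0 := rho1_ge0 R X.
have [-> _|z0 zB] := eqVneq z 0.
  exists 0; first exact: raddf0.
  by rewrite norm1_0 mule_ge0 ?lee_fin // inve_ge0.
pose P n := `[< exists2 A : chain2 X, bound2 A = z & norm1 A = n >].
have exP : exists n, P n.
  by case: zB => A _ AE; exists (norm1 A); apply/asboolP; exists A.
case: (ex_minnP exP) => n /asboolP[A AE nE] A_min; exists A => //.
have fillE : fill1 R z = (norm1 A)%:R%:E.
  apply/eqP; rewrite eq_le; apply/andP; split.
    by apply: ereal_inf_lbound; exists A.
  apply: le_ereal_inf_tmp => _ [A' A'E <-].
  by rewrite lee_fin ler_nat nE A_min //; apply/asboolP; exists A'.
have A0 : (0 < norm1 A)%N.
  rewrite lt0n norm1_eq0; apply: contraNneq z0 => A0.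
  by rewrite -AE A0 raddf0.
have nz0 : (0 < norm1 z)%N by rewrite lt0n norm1_eq0.
have : (rho1 R X <= (norm1 z)%:R%:E / (norm1 A)%:R%:E)%E.
  by apply: ereal_inf_lbound; exists z; rewrite ?fillE.
rewrite inver pnatr_eq0 eqn0Ngt A0 -EFinM.
move: rho0; case: (rho1 R X) => [r| |] //; rewrite !lee_fin => r0 r_le.
(* If [rho1] is zero its inverse is [+oo], and the bound is [+oo] because [norm1 z] is positive. *)
rewrite inver; case: eqVneq => [_|r_neq0].
  by rewrite mulry gtr0_sg ?ltr0n // mul1e leey.
rewrite -EFinM lee_fin ler_pdivlMr ?lt_def ?r_neq0 //.
by rewrite mulrC -ler_pdivlMr ?ltr0n.
Qed.

Lemma le_EFin_bigmax (R : realType) (I : finType) (F : I -> nat) (q : \bar R) :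
  (0 <= q)%E -> (forall i, ((F i)%:R%:E <= q)%E) -> ((\max_i F i)%:R%:E <= q)%E.
Proof.
move=> q0 Fq; elim/big_ind : _ => // m n mq nq.
by case: (leqP m n) => _.
Qed.

Theorem theorem0p2 (R : realType) (X Y : complex2) (phi : polygonal_map Y X)
    (X_connected : connected_complex X) (Y_connected : connected_complex Y)
    (phi_covering : covering phi) (phi_filling : filling phi)
    (H2X_neq0 : exists2 A : chain2 X, H2 A & A != 0) :
  (xi2 R X <=
     (kappa2 X)%:R%:E * ((2%:E * diam R Y + 1) / rho1 R X) + 1)%E.
Proof.
have [/card_gt0P[y0 _] Y_conn] := Y_connected.
have [c [cE c0 c_lip]] := minimal_chains (Y_conn y0).
set q : \bar R := ((2%:E * diam R Y + 1) / rho1 R X)%E.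
have rho_inv0 : (0 <= (rho1 R X)^-1)%E by rewrite inve_ge0 rho1_ge0.
have le_diam u : ((norm1 (c u))%:R%:E <= diam R Y)%E.
  exact: (@lip_le_diam R Y (fun u => norm1 (c u)) c_lip y0 u c0).
have diam0 : (0 <= diam R Y)%E by rewrite (le_trans _ (le_diam y0)) ?lee_fin.
have q0 : (0 <= q)%E by rewrite mule_ge0 // adde_ge0 // mule_ge0.
pose loop e : chain1 Y := basis_chain e - (c (tgt Y e) - c (src Y e)).
have loop_cycle e : bound1 (loop e) = 0.
  rewrite !raddfB /= !cE bound1_basis; apply/ffunP => v.
  by rewrite !ffunE; ring.
(* The connecting chains contribute [lin c (bound1 w)], zero for a cycle, so the loops of its edges
   add up to [w]. *)
have lin_loop w : bound1 w = 0 -> lin loop w = w.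
  move=> w0.
  have -> : lin loop w = lin (@basis_chain _) w -
      lin (fun e => c (tgt Y e) - c (src Y e)) w.
    by rewrite /lin -sumrB; apply: eq_bigr => e _; rewrite mulrzBl.
  rewrite lin_basis_chain -[RHS]subr0; congr (_ - _).
  rewrite -(raddf0 (lin c)) -w0 [bound1 w]additive_lin raddf_lin.
  by apply: eq_lin => e; rewrite /= bound1_basis raddfB /= !lin_basis.
have norm_loop e : ((norm1 (loop e))%:R%:E <= 2%:E * diam R Y + 1)%E.
  apply: (@le_trans _ _ ((norm1 (c (tgt Y e)) + norm1 (c (src Y e)) + 1)%:R%:E)).
    rewrite lee_fin ler_nat (leq_trans (norm1D _ _)) // norm1_basis norm1N.
    by rewrite addnC leq_add2r (leq_trans (norm1D _ _)) // norm1N.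
  by rewrite mule_natl mule2n !natrD !EFinD leeD2r // leeD.
have /choice[A AP] e : exists A : chain2 X,
    bound2 A = push1 phi (loop e) /\ ((norm1 A)%:R%:E <= q)%E.
  have [A AE A_le] := exists_filling R (phi_filling _ (loop_cycle e)).
  exists A; split=> //; apply: le_trans A_le _; rewrite lee_wpmul2r //.
  by apply: le_trans (norm_loop e); rewrite lee_fin ler_nat norm1_push1.
have fill_cycle w : bound1 w = 0 -> bound2 (lin A w) = push1 phi w.
  move=> w0; rewrite -[in RHS](lin_loop w w0) !raddf_lin /=.
  by apply: eq_lin => e; have [] := AP e.
pose S g : chain2 X :=
  basis_chain (pm_face phi g) *~ pm_sign phi g - lin A (cell_bound g).
have S_cycle g : bound2 (S g) = 0.
  rewrite raddfB raddfMz /= bound2_basis fill_cycle ?cell_bound_cycle //.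
  by rewrite push1_cell_bound subrr.
pose supp f := `[< exists2 Z : chain2 X, H2 Z & Z f != 0 >].
(* [kappa2] controls only cells in the support of a 2-cycle. The others are replaced by 0,
   harmlessly: every transferred cycle has coefficient 0 there. *)
pose T g := if supp (pm_face phi g) then S g else 0.
have T_cycle g : bound2 (T g) = 0 by rewrite /T; case: ifP; rewrite ?raddf0.
have T_span Z : bound2 Z = 0 ->
    exists a, sheet_mult phi Z = \sum_g T g *~ a g.
  move=> Z0; exists (transfer phi Z).
  rewrite (eq_bigr (fun g => S g *~ transfer phi Z g)) => [|g _]; last first.
    rewrite /T; case: ifP => // /asboolP Zg; rewrite ffunE.
    have -> : Z (pm_face phi g) = 0.
      by apply/eqP/negP => /negP Zg0; apply: Zg; exists Z.
    by rewrite mulr0 !mulr0z.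
  (* The fillings add up to [lin A] of the boundary of the lifted cycle, which is zero. *)
  transitivity (sheet_mult phi Z - lin A (bound2 (transfer phi Z))).
    by rewrite transfer_cycle // raddf0 subr0.
  rewrite [bound2 _]/(lin (@cell_bound Y) _) (raddf_lin (lin A)) sheet_multE.
  rewrite [X in _ - X]/lin -sumrB; apply: eq_bigr => g _ /=.
  by rewrite mulrzBl !ffunE -mulrzA mulrA pm_signK mul1r.
have [b [s [rank_H2 rank_T]]] := exists_full_rank (f := @bound2 X)
  (D := sheet_mult phi) (sheet_mult_inj phi_covering) T_cycle T_span.
(* Counting with an integer bound first avoids deciding whether [q] is finite. *)
set M := \max_e norm1 (A e).
have Mq : (M%:R%:E <= q)%E by apply: le_EFin_bigmax => // e; have [] := AP e.
have norm_T g : (norm1 (T g) <= kappa2 X * M + 1)%N.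
  rewrite /T; case: ifP => [g_supp|_]; last by rewrite norm1_0.
  rewrite addnC (leq_trans (norm1D _ _)) // leq_add //.
    by rewrite norm1Mz norm1_basis /pm_sign; case: (pm_flip phi g).
  rewrite norm1N (@leq_trans (M * norm1 (cell_bound g))) //.
    by apply: norm1_lin => e; rewrite /M (leq_bigmax e).
  rewrite mulnC leq_mul2r (leq_trans (norm1_cell_bound g)) ?orbT //.
  (* [phi] preserves the number of sides, and the image of [g] is among the cells that [kappa2]
     ranges over. *)
  by rewrite -(pm_sides phi g); exact: leq_bigmax_cond.
apply: ge_ereal_inf; exists (\max_(j < b) norm1 (T (s j)))%:R%:E.
  by exists b, (fun j => T (s j)); split=> // j; exact: T_cycle.
apply: (@le_trans _ _ (kappa2 X * M + 1)%:R%:E).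
  by rewrite lee_fin ler_nat; apply/bigmax_leqP => j _; exact: norm_T.
by rewrite natrD EFinD leeD2r // natrM EFinM lee_wpmul2l.
Qed.
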